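(* Let $\mathbb{K}$ be any infinite field, $n\in\mathbb{N}$, and let $d$ be an integer with $\frac{4(n^2+n)}{9}\le d\le n^2$. Then for a generic quadratic $\mathbb{K}$-algebra $R$ with $n$ generators and $d$ relations the Golod--Shafarevich estimate is attained; namely its Hilbert series is $$H_R(t)=\left|(1-nt+dt^2)^{-1}\right|=1+nt+(n^2-d)t^2+\max\{0,\,n^3-2nd\}\,t^3.$$
   Context: $\mathbb{N}=\{1,2,\dots\}$. A quadratic $\mathbb{K}$-algebra with $n$ generators and $d$ relations is $R=\mathbb{K}\langle x_1,\dots,x_n\rangle/I$, where all generators $x_i$ have degree $1$, and $I$ is the two-sided ideal generated by $d$ linearly independent homogeneous elements $f_j=\sum_{k,m=1}^n c_{j,k,m}x_kx_m$, $1\le j\le d$, $c_{j,k,m}\in\mathbb{K}$ ($0\le d\le n^2$). It is graded, $R=\bigoplus_{q\ge 0}R_q$, and its Hilbert series is $H_R(t)=\sum_{q\ge0}(\dim_{\mathbb{K}}R_q)t^q$. ''A generic quadratic $\mathbb{K}$-algebra with $n$ generators and $d$ relations has property $\mathcal{P}$'' means: the set of coefficient vectors $(c_{j,k,m})\in\mathbb{K}^{n^2d}$ for which the corresponding algebra $R$ has property $\mathcal{P}$ contains a dense Zariski open subset of $\mathbb{K}^{n^2d}$. For a formal power series $a(t)=\sum_{j\ge 0}a_jt^j$ with real coefficients, $|a(t)|$ denotes the series obtained from $a(t)$ by replacing all coefficients, starting from the first negative one, by zeros. *)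

(* Defs.v *)
From HB Require Import structures.
From mathcomp Require Import all_boot all_order all_algebra.
From mathcomp Require Import boolp finmap mpoly.

Set Implicit Arguments.
Unset Strict Implicit.
Unset Printing Implicit Defensive.

Import GRing.Theory Num.Theory.
Local Open Scope ring_scope.
Local Open Scope quotient_scope.

Section ZariskiTopology.
Variables (K : fieldType) (T : finType).

Definition zariski_open (U : {ffun T -> K} -> Prop) : Prop :=
  exists S : {mpoly K[#|T|]} -> Prop, forall c,
    U c <-> exists2 p, S p & p.@[fun i => c (enum_val i)] != 0.

Definition zariski_dense (U : {ffun T -> K} -> Prop) : Prop :=
  forall V, zariski_open V -> (exists c, V c) -> exists c, U c /\ V c.

Definition generic (P : {ffun T -> K} -> Prop) : Prop :=
  exists U, [/\ zariski_open U, zariski_dense U & forall c, U c -> P c].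

End ZariskiTopology.

(* Imported only here: monalg and mpoly share notations such as {mpoly R[n]}. *)
From mathcomp Require Import monalg.

(* An element of the two-sided ideal generated by a family f is a finite sum
   of products u * f i * v. *)
Definition in_ideal (A : nzRingType) (I : Type) (f : I -> A) (a : A) : Prop :=
  exists s : seq (A * I * A), a = \sum_(t <- s) t.1.1 * f t.1.2 * t.2.

Definition lin_indep (K : fieldType) (V : lmodType K) (m : nat)
    (v : 'I_m -> V) : Prop :=
  forall a : 'I_m -> K, \sum_(i < m) a i *: v i = 0 -> forall i, a i = 0.

(* The ambient space V may be infinite-dimensional, so the dimension of the
   subspace W is expressed by the existence of a basis with m elements. *)
Definition has_dim (K : fieldType) (V : lmodType K) (W : V -> Prop)
    (m : nat) : Prop :=
  exists b : 'I_m -> V, lin_indep b /\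
    forall v, W v <-> exists a : 'I_m -> K, v = \sum_(i < m) a i *: b i.

Notation free_algebra K n := {malg K[{fmonom 'I_n}]}.

Lemma malg_scalerAr (K : fieldType) (M : monomType) (a : K)
    (x y : {malg K[M]}) : a *: (x * y) = x * (a *: y).
Proof.
apply/malgP => k; rewrite mcoeffZ mcoeffMl mulr_sumr.
rewrite (mcoeffMlw _ (fsubset_refl _) (msuppZ_le _ _)).
apply: eq_bigr => u _; rewrite mulr_sumr; apply: eq_bigr => v _.
by rewrite mcoeffZ mulrnAr mulrCA.
Qed.

Section QuadraticAlgebra.
Variables (K : fieldType) (n d : nat).

Definition gen (i : 'I_n) : free_algebra K n := << fmu i >>.

Definition homogeneous (q : nat) (a : free_algebra K n) : Prop :=
  forall w : {fmonom 'I_n}, w \in msupp a -> fdeg w = q.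

(* c (j, k, m) is the coefficient of x_k x_m in the j-th relation. *)
Definition coef_vector := {ffun 'I_d * 'I_n * 'I_n -> K}.

Variable c : coef_vector.

Definition qrel (j : 'I_d) : free_algebra K n :=
  \sum_(k < n) \sum_(m < n) c (j, k, m) *: (gen k * gen m).

Definition qideal : {pred free_algebra K n} := fun a => `[< in_ideal qrel a >].

Lemma qidealP a : reflect (in_ideal qrel a) (a \in qideal).
Proof. exact: asboolP. Qed.

Lemma qideal_zmod_closed : zmod_closed qideal.
Proof.
split=> [|_ _ /qidealP[s ->] /qidealP[t ->]].
  by apply/qidealP; exists [::]; rewrite big_nil.
apply/qidealP; exists (s ++ [seq (- u.1.1, u.1.2, u.2) | u <- t]).
rewrite big_cat big_map /= -sumrN; congr (_ + _).
by apply: eq_bigr => u _; rewrite !mulNr.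
Qed.

HB.instance Definition _ :=
  GRing.isZmodClosed.Build (free_algebra K n) qideal qideal_zmod_closed.

Lemma qidealMl a u : u \in qideal -> a * u \in qideal.
Proof.
move=> /qidealP[s ->]; apply/qidealP.
exists [seq (a * t.1.1, t.1.2, t.2) | t <- s].
by rewrite big_map mulr_sumr; apply: eq_bigr => t _; rewrite !mulrA.
Qed.

Lemma qidealMr a u : u \in qideal -> u * a \in qideal.
Proof.
move=> /qidealP[s ->]; apply/qidealP.
exists [seq (t.1.1, t.1.2, t.2 * a) | t <- s].
by rewrite big_map mulr_suml; apply: eq_bigr => t _; rewrite !mulrA.
Qed.

Lemma qidealZ (a : K) u : u \in qideal -> a *: u \in qideal.
Proof. by move=> uI; rewrite -[u]mul1r scalerAl qidealMl. Qed.

Lemma qideal1 : 1 \notin qideal.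
Proof.
apply/negP => /qidealP[s] /(congr1 (mcoeff (@monalg.one {fmonom 'I_n}))).
rewrite rmorph1 rmorph_sum big1 => [/eqP|t _]; first by rewrite oner_eq0.
rewrite !rmorphM /= /qrel raddf_sum big1 => [|k _]; first by rewrite mulr0 mul0r.
rewrite raddf_sum big1 // => m _.
by rewrite /= mcoeffZ rmorphM /= mcoeffU1 fm1_eq1 mul0r mulr0.
Qed.

Definition qalg := Quotient.quot (qideal : zmodClosed (free_algebra K n)).
HB.instance Definition _ := GRing.Zmodule.on qalg.
HB.instance Definition _ := Quotient.on qalg.

Definition qalg_pi (a : free_algebra K n) : qalg := \pi_qalg a.

Lemma qalg_piP a b : (qalg_pi a = qalg_pi b) <-> a - b \in qideal.
Proof. by rewrite (Quotient.idealrBE (qideal : zmodClosed _)); split=> /eqP. Qed.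

Lemma qalg_piK (x : qalg) : qalg_pi (repr x) = x.
Proof. exact: reprK. Qed.

Lemma qalg_piB : zmod_morphism qalg_pi.
Proof. by move=> a b; rewrite /qalg_pi raddfB. Qed.
HB.instance Definition _ :=
  GRing.isZmodMorphism.Build (free_algebra K n) qalg qalg_pi qalg_piB.

Definition qalg_one : qalg := qalg_pi 1.
Definition qalg_mul (x y : qalg) : qalg := qalg_pi (repr x * repr y).
Definition qalg_scale (a : K) (x : qalg) : qalg := qalg_pi (a *: repr x).

Lemma qalg_repr_pi a : repr (qalg_pi a) - a \in qideal.
Proof. by apply/qalg_piP; rewrite qalg_piK. Qed.

Lemma qalg_mul_pi a b : qalg_mul (qalg_pi a) (qalg_pi b) = qalg_pi (a * b).
Proof.
apply/qalg_piP; set a' := repr _; set b' := repr _.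
have -> : a' * b' - a * b = (a' - a) * b' + a * (b' - b).
  by rewrite mulrBl mulrBr addrA subrK.
by apply: rpredD; [apply: qidealMr|apply: qidealMl]; apply: qalg_repr_pi.
Qed.

Lemma qalg_scale_pi k a : qalg_scale k (qalg_pi a) = qalg_pi (k *: a).
Proof. by apply/qalg_piP; rewrite -scalerBr qidealZ ?qalg_repr_pi. Qed.

Lemma qalg_mulA : associative qalg_mul.
Proof.
move=> x y z; rewrite -[x]qalg_piK -[y]qalg_piK -[z]qalg_piK.
by rewrite !qalg_mul_pi mulrA.
Qed.

Lemma qalg_mul1x : left_id qalg_one qalg_mul.
Proof. by move=> x; rewrite -[x]qalg_piK qalg_mul_pi mul1r. Qed.

Lemma qalg_mulx1 : right_id qalg_one qalg_mul.
Proof. by move=> x; rewrite -[x]qalg_piK qalg_mul_pi mulr1. Qed.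

Lemma qalg_mulDl : left_distributive qalg_mul +%R.
Proof.
move=> x y z; rewrite -[x]qalg_piK -[y]qalg_piK -[z]qalg_piK.
by rewrite -raddfD !qalg_mul_pi mulrDl raddfD.
Qed.

Lemma qalg_mulDr : right_distributive qalg_mul +%R.
Proof.
move=> x y z; rewrite -[x]qalg_piK -[y]qalg_piK -[z]qalg_piK.
by rewrite -raddfD !qalg_mul_pi mulrDr raddfD.
Qed.

Lemma qalg_one_neq0 : qalg_one != 0.
Proof.
apply: contra qideal1 => /eqP; rewrite -(raddf0 qalg_pi) => /qalg_piP.
by rewrite subr0.
Qed.

HB.instance Definition _ := GRing.Zmodule_isNzRing.Build qalg
  qalg_mulA qalg_mul1x qalg_mulx1 qalg_mulDl qalg_mulDr qalg_one_neq0.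

Lemma qalg_scaleA k l x : qalg_scale k (qalg_scale l x) = qalg_scale (k * l) x.
Proof. by rewrite -[x]qalg_piK !qalg_scale_pi scalerA. Qed.

Lemma qalg_scale1 : left_id 1 qalg_scale.
Proof. by move=> x; rewrite -[x]qalg_piK qalg_scale_pi scale1r. Qed.

Lemma qalg_scaleDr : right_distributive qalg_scale +%R.
Proof.
move=> k x y; rewrite -[x]qalg_piK -[y]qalg_piK.
by rewrite -raddfD !qalg_scale_pi scalerDr raddfD.
Qed.

Lemma qalg_scaleDl x : {morph qalg_scale^~ x : k l / k + l}.
Proof.
by move=> k l; rewrite -[x]qalg_piK !qalg_scale_pi scalerDl raddfD.
Qed.

HB.instance Definition _ := GRing.Zmodule_isLmodule.Build K qalg
  qalg_scaleA qalg_scale1 qalg_scaleDr qalg_scaleDl.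

Lemma qalg_scaleAl (k : K) (x y : qalg) : k *: (x * y) = k *: x * y.
Proof.
rewrite -[x]qalg_piK -[y]qalg_piK.
rewrite [LHS](congr1 (qalg_scale k) (qalg_mul_pi _ _)) qalg_scale_pi scalerAl.
by rewrite -qalg_mul_pi -qalg_scale_pi.
Qed.

HB.instance Definition _ := GRing.Lmodule_isLalgebra.Build K qalg qalg_scaleAl.

Lemma qalg_scaleAr (k : K) (x y : qalg) : k *: (x * y) = x * (k *: y).
Proof.
rewrite -[x]qalg_piK -[y]qalg_piK.
rewrite [LHS](congr1 (qalg_scale k) (qalg_mul_pi _ _)) qalg_scale_pi.
by rewrite malg_scalerAr -qalg_mul_pi -qalg_scale_pi.
Qed.

HB.instance Definition _ := GRing.Lalgebra_isAlgebra.Build K qalg qalg_scaleAr.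

Definition qalg_component (q : nat) (x : qalg) : Prop :=
  exists2 a : free_algebra K n, homogeneous q a & x = qalg_pi a.

Definition is_hilbert_series (H : nat -> int) : Prop :=
  forall q, exists2 m : nat, has_dim (qalg_component q) m & H q = m%:Z.

End QuadraticAlgebra.

(* A formal power series is represented by its sequence of coefficients. *)

Definition fps_of_poly (R : nzRingType) (p : {poly R}) : nat -> R :=
  fun k => p`_k.

Definition fps_mul (R : nzRingType) (a b : nat -> R) : nat -> R :=
  fun k => \sum_(i < k.+1) a i * b (k - i)%N.

(* The coefficients of the inverse b of a are determined, in order, by
   a_0 b_k + \sum_(i < k) a_(k - i) b_i = [k = 0]. *)
Fixpoint fps_inv_prefix (R : unitRingType) (a : nat -> R) (k : nat) : seq R :=
  if k is k'.+1 then
    let s := fps_inv_prefix a k' in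
    rcons s ((a 0%N)^-1 *
             ((k' == 0%N)%:R - \sum_(i < k') a (k' - i)%N * s`_i))
  else [::].

Definition fps_inv (R : unitRingType) (a : nat -> R) : nat -> R :=
  fun k => (fps_inv_prefix a k.+1)`_k.

Lemma size_fps_inv_prefix (R : unitRingType) (a : nat -> R) k :
  size (fps_inv_prefix a k) = k.
Proof. by elim: k => //= k IHk; rewrite size_rcons IHk. Qed.

Lemma nth_fps_inv_prefix (R : unitRingType) (a : nat -> R) k i :
  (i < k)%N -> (fps_inv_prefix a k)`_i = fps_inv a i.
Proof.
elim: k => // k IHk; rewrite ltnS leq_eqVlt => /orP[/eqP->//|lt_ik].
by rewrite /= nth_rcons size_fps_inv_prefix lt_ik IHk.
Qed.

Lemma fps_mulV (R : unitRingType) (a : nat -> R) : a 0%N \is a GRing.unit ->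
  fps_mul a (fps_inv a) =1 fps_of_poly 1.
Proof.
move=> a0U k; rewrite /fps_mul /fps_of_poly coef1.
rewrite (reindex_inj rev_ord_inj) big_ord_recr /= subnn subn0.
rewrite {2}/fps_inv /= nth_rcons size_fps_inv_prefix ltnn eqxx mulVKr //.
rewrite addrC -[RHS](subrK (\sum_(i < k) a (k - i)%N * fps_inv a i)).
congr (_ - _ + _); apply: eq_bigr => i _.
  by rewrite nth_fps_inv_prefix.
by rewrite subSS subKn // ltnW.
Qed.

(* |a| as in the Golod-Shafarevich estimate: zero from the first negative
   coefficient on. *)
Definition fps_abs (R : realDomainType) (a : nat -> R) : nat -> R :=
  fun k => if [forall i : 'I_k.+1, 0 <= a i] then a k else 0.

Definition golod_shafarevich (n d : nat) : nat -> int :=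
  fps_abs (fps_inv (fps_of_poly (1 - n%:Z *: 'X + d%:Z *: 'X^2))).

(* Main.v *)
From HB Require Import structures.
Require Import Defs.
From mathcomp Require Import all_boot all_order all_algebra.
From mathcomp Require Import finmap zify ring.
From mathcomp Require mpoly monalg.

(** The degree q part of the ideal of relations is spanned by the products
    u * f_j * v, where u and v are words of total length q - 2. Their
    coordinates in the basis of words of length q form a matrix depending
    linearly on the coefficient vector c, and dim R_q is n^q minus its rank
    (component_dim). Hence the theorem amounts to three lower bounds on ranks:
    rank d in degree 2, which also says that the relations are independent;
    rank min (n^3, 2nd) in degree 3; and rank n^4 in degree 4, after which all
    higher components vanish. The reverse inequalities hold for every c, by
    counting rows and columns.

    A lower bound on the rank is a Zariski open condition, and over an infinite
    field finitely many nonempty open sets have a common point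
    (rank_off_hypersurface, off_hypersurface_and). So it is enough to find, for
    each degree separately, a single algebra attaining the bound, and the three
    algebras may be different. A rank is bounded below by computing in the
    quotient: if all words of length q are spanned by k elements modulo the
    relations, then the rank is at least n^q - k (rank_of_span).

    In degree 2, monomial relations will do. The other witnesses are obtained by
    replacing the variables of a small algebra by families of variables and each
    relation of it by all its indexed copies. In degree 4 the small algebra has
    three generators and the relations xz = yz = xx - yy = yx - zz = 0, and all
    its words of length 4 vanish (letters4_0). Distributing the n generators as
    evenly as possible among x, y and z leaves at most 4 (n^2 + n) / 9, rounded
    up, nonzero relations (size_relations4), and this is the origin of the bound
    on d.

    In degree 3 the small algebra has the relations xy = xx - yy = 0, for which
    all words of length 3 vanish. This gives n^2 / 2 relations for n even. For
    n odd there is one more generator z, with the relations z x = (x + y) z and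
    z y = y z, and the words of length 3 are spanned by the n elements
    g z z with g a generator (letters3_span); for d = (n^2 - 1) / 2 their number
    is exactly n^3 - 2nd. Smaller d are reached by dropping relations, and
    larger d by imposing also z z = 0.

    It remains to observe that the inverse of 1 - nt + dt^2 has a negative
    coefficient in degree 3 or 4, so that its truncation is a polynomial of
    degree at most 3 (golod_shafarevich_poly). *)

Import Order.TTheory GRing.Theory Num.Theory.
Local Open Scope ring_scope.

Set Implicit Arguments.
Unset Strict Implicit.
Unset Printing Implicit Defensive.

(** * Polynomial conditions over an infinite field *)

Section Zariski.
Import mpoly.
Variables (K : fieldType) (T : finType).
Hypothesis K_infinite : forall s : seq K, exists x : K, x \notin s.

Definition eval_at (p : {mpoly K[#|T|]}) (c : {ffun T -> K}) : K :=
  p.@[fun i => c (enum_val i)].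

Lemma infinite_nonroot (p : {poly K}) : p != 0 -> exists t, p.[t] != 0.
Proof using K_infinite.
move=> p0; have [s [us ss]]: exists s : seq K, uniq s /\ size s = size p.
  elim: (size p) => [|k [s [us ss]]]; first by exists [::].
  by have [x xs] := K_infinite s; exists (x :: s); rewrite /= xs us ss.
have [rs|/allPn[t _ pt]] := boolP (all (root p) s); last by exists t.
by have := max_poly_roots p0 rs us; rewrite ss ltnn.
Qed.

Lemma restrict_to_line (p : {mpoly K[#|T|]}) (a b : {ffun T -> K}) :
  exists P : {poly K},
    forall t, P.[t] = eval_at p [ffun j => a j + t * (b j - a j)].
Proof.
pose l (i : 'I_#|T|) :=
  (a (enum_val i))%:P + 'X * (b (enum_val i) - a (enum_val i))%:P.
exists (mmap (@polyC K) l p) => t.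
rewrite /eval_at mevalE /mmap horner_sum; apply: eq_bigr => m _.
rewrite hornerM hornerC /mmap1 horner_prod; congr (_ * _).
by apply: eq_bigr => i _; rewrite horner_exp /l !hornerE ffunE.
Qed.

(** On the line through a and b both polynomials become nonzero polynomials in
    one variable, and their product has a nonroot because K is infinite. *)
Lemma common_nonzero (p q : {mpoly K[#|T|]}) a b :
  eval_at p a != 0 -> eval_at q b != 0 ->
  exists c, eval_at p c * eval_at q c != 0.
Proof using K_infinite.
move=> pa qb; have [P HP] := restrict_to_line p a b.
have [Q HQ] := restrict_to_line q a b.
have P0 : P != 0.
  apply: contraNneq pa => P0; have := HP 0; rewrite P0 horner0 => ->.
  by apply/eqP; congr eval_at; apply/ffunP => j; rewrite ffunE mul0r addr0.
have Q0 : Q != 0.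
  apply: contraNneq qb => Q0; have := HQ 1; rewrite Q0 horner0 => ->.
  apply/eqP; congr eval_at; apply/ffunP => j.
  by rewrite ffunE mul1r addrC subrK.
have [t] : exists t, (P * Q).[t] != 0.
  by apply: infinite_nonroot; rewrite mulf_neq0.
by rewrite hornerM HP HQ; exists [ffun j => a j + t * (b j - a j)].
Qed.

(** The special shape in which genericity is always established here: stable
    under conjunction, and witnessed by a single good point. *)
Definition off_hypersurface (P : {ffun T -> K} -> Prop) : Prop :=
  exists p : {mpoly K[#|T|]},
    (exists c, eval_at p c != 0) /\ forall c, eval_at p c != 0 -> P c.

Lemma off_hypersurface_and P Q :
  off_hypersurface P -> off_hypersurface Q ->
  off_hypersurface (fun c => P c /\ Q c).
Proof using K_infinite.
move=> [p [[a pa] pP]] [q [[b qb] qQ]]; exists (p * q).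
have [c pqc] := common_nonzero pa qb.
split=> [|e]; first by exists c; rewrite /eval_at mevalM.
rewrite /eval_at mevalM mulf_eq0 negb_or => /andP[pe qe].
by split; [apply: pP|apply: qQ].
Qed.

Lemma off_hypersurface_generic P : off_hypersurface P -> generic P.
Proof using K_infinite.
move=> [p [[a pa] pP]]; exists (fun c => eval_at p c != 0); split=> //.
  exists (eq p) => c; split=> [pc|[_ <- //]]; by exists p.
move=> V [S SV] [b /SV[q Sq qb]].
have [c] := common_nonzero pa qb.
rewrite mulf_eq0 negb_or => /andP[pc qc].
by exists c; split=> //; apply/SV; exists q.
Qed.

(** Having rank at least r is an open condition on a matrix depending linearly
    on c: if L *m M c0 *m R is the identity of size r, then the polynomial
    \det (L *m M c *m R) is nonzero at c0, and wherever it does not vanish the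
    rank is at least r. *)
Lemma rank_off_hypersurface m N (A : T -> 'M[K]_(m, N)) r (c0 : {ffun T -> K}) :
  (r <= \rank (\sum_t c0 t *: A t)%R)%N ->
  off_hypersurface (fun c => (r <= \rank (\sum_t c t *: A t)%R))%N.
Proof.
set M0 := \sum_t _ => rM.
have [L [R LMR]] : exists (L : 'M[K]_(r, m)) (R : 'M[K]_(N, r)),
    L *m M0 *m R = 1%:M.
  have [L HL] := row_fullP (col_base_full M0).
  have [R HR] := row_freeP (row_base_free M0).
  pose P : 'M[K]_(r, \rank M0) := pid_mx r.
  pose Q : 'M[K]_(\rank M0, r) := pid_mx r.
  exists (P *m L), (R *m Q).
  have -> : P *m L *m M0 *m (R *m Q) =
      P *m (L *m col_base M0) *m (row_base M0 *m R) *m Q.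
    move: (col_base M0) (row_base M0) (mulmx_base M0) => C B defM.
    by rewrite !mulmxA -[P *m L *m C *m B]mulmxA defM.
  rewrite HL HR !mulmx1.
  by rewrite pid_mx_id // pid_mx_1.
pose M : 'M[{mpoly K[#|T|]}]_(m, N) :=
  \sum_t 'X_(enum_rank t) *: map_mx (@mpolyC #|T| K) (A t).
pose v (c : {ffun T -> K}) (i : 'I_#|T|) := c (enum_val i).
have evM c : map_mx (meval (v c)) M = \sum_t c t *: A t.
  rewrite raddf_sum; apply: eq_bigr => t _ /=.
  apply/matrixP => i j; rewrite !mxE mevalM mevalXU mevalC.
  by rewrite /v enum_rankK.
pose p := \det (map_mx (@mpolyC _ K) L *m M *m map_mx (@mpolyC _ K) R).
have evp c : eval_at p c = \det (L *m (\sum_t c t *: A t) *m R).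
  rewrite /eval_at -/(v c) -det_map_mx !map_mxM /= evM.
  by congr (\det (_ *m _ *m _)); apply/matrixP => i j; rewrite !mxE mevalC.
exists p; split; first by exists c0; rewrite evp LMR det1 oner_neq0.
move=> c; rewrite evp -unitfE -unitmxE => /mxrank_unit LcR.
by rewrite -[leqLHS]LcR (leq_trans (mxrankM_maxl _ _)) ?mxrankM_maxr.
Qed.

End Zariski.

(** * The degree q part of the ideal *)

Import monalg.

Section Words.
Variables (K : fieldType) (n : nat).

Definition word (s : seq 'I_n) : free_algebra K n := << FMonom s >>.

Lemma wordM s t : word s * word t = word (s ++ t).
Proof.
rewrite /word malgM_def fgmulUU mulr1; congr mkmalgU.
by apply/eqP; rewrite fmP fmM.
Qed.

Lemma word_nil : word [::] = 1.
Proof. by rewrite /word -fmoneE. Qed.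

Lemma gen_word i : gen K i = word [:: i].
Proof. by rewrite /gen fmuE. Qed.

Lemma mcoeff_word s (w : {fmonom 'I_n}) : (word s)@_w = (s == w)%:R :> K.
Proof. by rewrite mcoeffU1 fmP. Qed.

Lemma word_expand (a : free_algebra K n) :
  a = \sum_(w <- msupp a) a@_w *: word w.
Proof.
apply/malgP => k; rewrite [in LHS](monalgE a) !raddf_sum /=.
by apply: eq_bigr => w _; rewrite mcoeffZ mcoeffU1 mcoeffU fmK mulr_natr.
Qed.

Lemma word_expand_mull (a b : free_algebra K n) :
  a * b = \sum_(w <- msupp a) a@_w *: (word w * b).
Proof.
under eq_bigr do rewrite scalerAl.
by rewrite -big_distrl /= -word_expand.
Qed.

Lemma word_expand_mulr (a b : free_algebra K n) :
  b * a = \sum_(w <- msupp a) a@_w *: (b * word w).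
Proof.
under eq_bigr do rewrite malg_scalerAr.
by rewrite -big_distrr /= -word_expand.
Qed.

End Words.

Section DegreePart.
Variables (K : fieldType) (n d q : nat).
Notation A := (free_algebra K n).
Notation N := #|{: q.-tuple 'I_n}|.
Notation X := {: 'I_q.-1 * (q.-2).-tuple 'I_n * 'I_d}.

(** An index (i, s, j) stands for the element u * f_j * v of the ideal, where s
    is the concatenation of u and v, and u consists of the first i letters of s.
    For q < 2 the type of the positions i is empty. *)
Definition prefix_of (x : X) : seq 'I_n := take x.1.1 x.1.2.
Definition suffix_of (x : X) : seq 'I_n := drop x.1.1 x.1.2.

Lemma card_words : N = (n ^ q)%N.
Proof. by rewrite card_tuple card_ord. Qed.

Definition coef_row (a : A) : 'rV[K]_N :=
  \row_(i < N) a@_(FMonom (enum_val i)).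

Definition of_row (v : 'rV[K]_N) : A :=
  \sum_(i < N) v 0 i *: word K (enum_val i).

Lemma coef_row_is_linear : linear coef_row.
Proof. by move=> k a b; apply/rowP => i; rewrite !mxE mcoeffD mcoeffZ. Qed.
HB.instance Definition _ :=
  GRing.isLinear.Build K A 'rV[K]_N _ coef_row coef_row_is_linear.

Lemma coef_rowZ k a : coef_row (k *: a) = k *: coef_row a.
Proof. exact: linearZ. Qed.

Lemma of_row_is_linear : linear of_row.
Proof.
move=> k u v; rewrite /of_row scaler_sumr -big_split /=.
by apply: eq_bigr => i _; rewrite !mxE scalerDl scalerA.
Qed.
HB.instance Definition _ :=
  GRing.isLinear.Build K 'rV[K]_N A _ of_row of_row_is_linear.

Lemma of_rowZ k v : of_row (k *: v) = k *: of_row v.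
Proof. exact: linearZ. Qed.

Lemma of_rowK : cancel of_row coef_row.
Proof.
move=> v; apply/rowP => i; rewrite mxE raddf_sum (bigD1 i) //= big1.
  by rewrite mcoeffZ mcoeff_word eqxx mulr1 addr0.
move=> j ji; rewrite mcoeffZ mcoeff_word.
by rewrite val_eqE (inj_eq enum_val_inj) (negPf ji) mulr0.
Qed.

Lemma of_row_homogeneous v : homogeneous q (of_row v).
Proof.
move=> w; rewrite -mcoeff_neq0; apply: contraNeq => wq.
rewrite raddf_sum big1 // => i _; rewrite /= mcoeffZ mcoeff_word.
case: eqP => [iw|_]; last by rewrite mulr0.
by case/eqP: wq; rewrite /fdeg -iw size_tuple.
Qed.

Lemma coef_rowK a : homogeneous q a -> of_row (coef_row a) = a.
Proof.
move=> ha; apply/malgP => w; rewrite raddf_sum /=.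
have [wq|wq] := eqVneq (size w) q; last first.
  have wa : w \notin msupp a by apply: contra wq => /ha <-.
  rewrite (mcoeff_outdom wa) big1 // => i _.
  rewrite mcoeffZ mcoeff_word; case: eqP => [iw|_]; last by rewrite mulr0.
  by rewrite -iw size_tuple eqxx in wq.
have wq' : size w == q by apply/eqP.
rewrite (bigD1 (enum_rank (Tuple wq'))) //= big1.
  by rewrite mcoeffZ !mxE enum_rankK mcoeff_word /= eqxx fmK mulr1 addr0.
move=> i iw; rewrite mcoeffZ mcoeff_word.
case: eqP => [e|_]; last by rewrite mulr0.
by case/eqP: iw; apply: enum_val_inj; rewrite enum_rankK; apply: val_inj.
Qed.

(** The factor of c t in the matrix of relations: for t = (j, k, m), the term
    x_k x_m of f_j contributes the word u x_k x_m v to u * f_j * v. *)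
Definition relation_mx_part (t : 'I_d * 'I_n * 'I_n) : 'M[K]_(#|X|, N) :=
  \matrix_(x < #|X|, y < N)
    let: r := enum_val x in
    ((r.2 == t.1.1) &&
     (prefix_of r ++ [:: t.1.2; t.2] ++ suffix_of r == enum_val y))%:R.

(** The row space of this matrix is the degree q part of the ideal. Writing it
    as a linear function of c makes its rank a subject of genericity. *)
Definition relation_mx (c : coef_vector K n d) : 'M[K]_(#|X|, N) :=
  \sum_t c t *: relation_mx_part t.

Section Fixed.
Variable c : coef_vector K n d.

Lemma qrel_words j : qrel c j = \sum_k \sum_m c (j, k, m) *: word K [:: k; m].
Proof.
by apply: eq_bigr => k _; apply: eq_bigr => m _; rewrite !gen_word wordM.
Qed.

Lemma word_qrel_word s j t : word K s * qrel c j * word K t =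
  \sum_k \sum_m c (j, k, m) *: word K (s ++ [:: k; m] ++ t).
Proof.
rewrite qrel_words mulr_sumr mulr_suml; apply: eq_bigr => k _.
rewrite mulr_sumr mulr_suml; apply: eq_bigr => m _.
by rewrite -malg_scalerAr -scalerAl !wordM -catA.
Qed.

Lemma row_relation_mx x : row x (relation_mx c) =
  let: r := enum_val x in
  coef_row (word K (prefix_of r) * qrel c r.2 * word K (suffix_of r)).
Proof.
rewrite /= word_qrel_word.
apply/rowP => y; rewrite mxE [RHS]mxE summxE raddf_sum /=.
under eq_bigr do rewrite !mxE.
move: (enum_val x) => r.
under [RHS]eq_bigr do rewrite raddf_sum /=.
rewrite pair_bigA (bigID (fun t => t.1.1 == r.2)) /= addrC.
rewrite big1 => [|t /negPf tr].
  rewrite add0r.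
  rewrite (reindex_onto (fun p => (r.2, p.1, p.2)) (fun t => (t.1.2, t.2))).
    apply: eq_big => [[k m]|[k m] _]; first by rewrite /= !eqxx.
    by rewrite /= eqxx mcoeffZ mcoeff_word.
  by move=> [[j k] m] /= /eqP->.
by rewrite eq_sym tr mulr0.
Qed.

Lemma word_relation_sub s j t :
  (coef_row (word K s * qrel c j * word K t) <= relation_mx c)%MS.
Proof.
have [sz|sz] := eqVneq (size s + size t).+2 q.
  have szst : size (s ++ t) == q.-2 by rewrite size_cat -sz.
  have lts : (size s < q.-1)%N by rewrite -sz /= ltnS leq_addr.
  pose r : X := (Ordinal lts, Tuple szst, j).
  have Es : prefix_of r = s by apply: take_size_cat.
  have Et : suffix_of r = t by apply: drop_size_cat.
  suff -> : coef_row (word K s * qrel c j * word K t) =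
      row (enum_rank r) (relation_mx c) by apply: row_sub.
  by rewrite row_relation_mx enum_rankK Es Et.
suff -> : coef_row (word K s * qrel c j * word K t) = 0 by apply: sub0mx.
rewrite word_qrel_word; apply/rowP => y; rewrite !mxE raddf_sum big1 // => k _.
rewrite raddf_sum big1 // => m _ /=; rewrite mcoeffZ mcoeff_word.
case: eqP => [e|]; last by rewrite mulr0.
case/eqP: sz; rewrite -(size_tuple (enum_val y)) -[tval _]e !size_cat /=.
by rewrite !addnS.
Qed.

(** Expanding the two outer factors of a * f_j * b in words leaves in degree q
    only scalar multiples of rows of the matrix. *)
Lemma coef_row_ideal a : a \in qideal c -> (coef_row a <= relation_mx c)%MS.
Proof.
move=> /qidealP[l ->]; rewrite raddf_sum; apply: summx_sub => [[[u j] v] _] /=.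
rewrite -mulrA word_expand_mull raddf_sum; apply: summx_sub => s _ /=.
rewrite mulrA word_expand_mulr scaler_sumr raddf_sum.
apply: summx_sub => t _; rewrite /= !coef_rowZ.
by do 2!apply: scalemx_sub; apply: word_relation_sub.
Qed.

Lemma of_row_ideal v : (v <= relation_mx c)%MS -> of_row v \in qideal c.
Proof.
move=> /submxP[w ->]; rewrite mulmx_sum_row raddf_sum; apply: rpred_sum => x _.
rewrite /= of_rowZ qidealZ // row_relation_mx /=; move: (enum_val x) => r.
have szr : (size (prefix_of r) + 2 + size (suffix_of r))%N = q.
  case: r => [[i s] j]; rewrite /prefix_of /suffix_of /=.
  move: (nat_of_ord i) (ltn_ord i) => k ltk.
  by rewrite size_takel ?size_drop size_tuple; lia.
rewrite coef_rowK; last first.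
  move=> w'; rewrite word_qrel_word -mcoeff_neq0; apply: contraNeq => wq.
  rewrite raddf_sum big1 // => k _; rewrite raddf_sum big1 // => m _ /=.
  rewrite mcoeffZ mcoeff_word; case: eqP => [e|_]; last by rewrite mulr0.
  by case/eqP: wq; rewrite /fdeg -e !size_cat -szr /= -addnA.
apply: qidealMr; apply: qidealMl; apply/qidealP.
by exists [:: (1, r.2, 1)]; rewrite big_seq1 /= mul1r mulr1.
Qed.

Lemma of_row_comb k (a : 'I_k -> K) (C : 'M[K]_(k, N)) :
  of_row ((\row_i a i) *m C) = \sum_i a i *: of_row (row i C).
Proof.
rewrite mulmx_sum_row (raddf_sum of_row); apply: eq_bigr => i _.
by rewrite -of_rowZ mxE.
Qed.

Lemma qalg_pi_comb k (a : 'I_k -> K) (e : 'I_k -> A) :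
  qalg_pi c (\sum_i a i *: e i) = \sum_i a i *: qalg_pi c (e i).
Proof.
rewrite (raddf_sum (qalg_pi c)); apply: eq_bigr => i _.
by rewrite -[RHS]/(qalg_scale _ _) qalg_scale_pi.
Qed.

(** The row space of the matrix has a complement of dimension n^q - rank, whose
    basis maps to a basis of R_q. *)
Lemma component_dim :
  has_dim (@qalg_component K n d c q) (n ^ q - \rank (relation_mx c)).
Proof.
set M := relation_mx c; pose C := row_base (M^C)%MS.
have rC : \rank (M^C)%MS = (n ^ q - \rank M)%N.
  by rewrite mxrank_compl -card_words.
rewrite -rC; exists (fun i => qalg_pi c (of_row (row i C))).
have sumE a : \sum_i a i *: qalg_pi c (of_row (row i C)) =
    qalg_pi c (of_row ((\row_i a i) *m C)).
  by rewrite of_row_comb qalg_pi_comb.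
split=> [a|x].
  rewrite sumE -[RHS](raddf0 (qalg_pi c)) => /qalg_piP.
  rewrite subr0 => /coef_row_ideal; rewrite of_rowK -/M => aM.
  have aC : ((\row_i a i) *m C <= M^C)%MS.
    by rewrite (submx_trans (submxMl _ _)) // eq_row_base.
  have : ((\row_i a i) *m C <= M :&: M^C)%MS by rewrite sub_capmx aM aC.
  rewrite (capmx_compl M) submx0 => /eqP aC0 i.
  have := row_free_inj (row_base_free (M^C)%MS)
    (etrans aC0 (esym (mul0mx _ _))).
  by move/rowP/(_ i); rewrite !mxE.
split=> [[a ha ->]|[a ->]]; last first.
  rewrite sumE; exists (of_row ((\row_i a i) *m C)) => //.
  exact: of_row_homogeneous.
have : (coef_row a <= M + M^C)%MS.
  by rewrite (submx_trans (submx1 _)) // sub1mx addsmx_compl_full.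
case/sub_addsmxP => [[u v]] /= Ea.
have : (v *m M^C <= C)%MS by rewrite eq_row_base submxMl.
case/submxP => w Ew; exists (fun i => w 0 i).
rewrite sumE; apply/qalg_piP.
have -> : \row_i w 0 i = w by apply/rowP => i; rewrite mxE.
rewrite -Ew -(coef_rowK ha) -raddfB Ea addrK.
by apply: of_row_ideal; apply: submxMl.
Qed.

(** A lower bound on the rank is obtained by computing in the quotient algebra:
    it is enough to find few elements that span all words of length q. The
    elements e_i need not be homogeneous, as only their degree q parts enter. *)
Lemma rank_of_span k (e : 'I_k -> A) :
  (forall w : q.-tuple 'I_n, exists a : 'I_k -> K,
     qalg_pi c (word K w) = \sum_i a i *: qalg_pi c (e i)) ->
  (n ^ q <= \rank (relation_mx c) + k)%N.
Proof.
move=> span; set M := relation_mx c.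
pose E : 'M[K]_(k, N) := \matrix_i coef_row (e i).
have : (1%:M <= M + E)%MS.
  apply/row_subP => y; have [a] := span (enum_val y).
  rewrite -qalg_pi_comb.
  move/qalg_piP/coef_row_ideal; rewrite raddfB /= => ME.
  have -> : row y 1%:M = coef_row (word K (enum_val y)).
    apply/rowP => z; rewrite !mxE mcoeff_word /= val_eqE.
    by rewrite (inj_eq enum_val_inj).
  rewrite -[coef_row _](subrK (coef_row (\sum_i a i *: e i))).
  rewrite addmx_sub_adds // raddf_sum; apply: summx_sub => i _.
  rewrite /= coef_rowZ; apply: scalemx_sub.
  by have := row_sub i E; rewrite rowK.
move/mxrankS; rewrite mxrank1 -card_words => /leq_trans-> //.
apply: leq_trans (mxrank_adds_leqif _ _) _.
by rewrite leq_add2l rank_leq_row.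
Qed.

Lemma rank_relation_mx_le :
  (\rank (relation_mx c) <= minn (n ^ q) (q.-1 * n ^ q.-2 * d))%N.
Proof.
rewrite leq_min -card_words rank_leq_col /=.
apply: leq_trans (rank_leq_row _) _.
by rewrite !card_prod card_tuple !card_ord.
Qed.

End Fixed.
End DegreePart.

(** * Two ring computations *)

Definition letter (R : Type) (x y z : nat -> R) (t : nat) : nat -> R :=
  if t is t'.+1 then if t' is 0%N then y else z else x.

Section FourLetters.
Variables (R : pzRingType) (x y z : nat -> R).
Hypotheses (xz : forall a b, x a * z b = 0) (yz : forall a b, y a * z b = 0)
  (yy : forall a b, y a * y b = x a * x b)
  (zz : forall a b, z a * z b = y a * x b).

(** Without the indices these are four relations in three variables: xz = yz =
    yy - xx = zz - yx = 0. Oriented from left to right as xz -> 0, yz -> 0,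
    yy -> xx, zz -> yx, they are completed up to degree 4 by xxx -> 0,
    xyx -> 0, zyx -> 0, yxx -> xxy and zxxy -> 0, and then every word of
    length 4 reduces to 0. No step moves a letter to another position or
    inspects an index, so that the same computation holds for all indices. *)
Lemma letters4_0 t1 t2 t3 t4 a b c e :
  letter x y z t1 a * letter x y z t2 b * letter x y z t3 c *
    letter x y z t4 e = 0.
Proof.
(* Products associate to the left, so each rule is also needed behind a
   prefix r. *)
have xzr r a' b' : r * x a' * z b' = 0 by rewrite -mulrA xz mulr0.
have yzr r a' b' : r * y a' * z b' = 0 by rewrite -mulrA yz mulr0.
have yyr r a' b' : r * y a' * y b' = r * x a' * x b' by rewrite -mulrA yy mulrA.
have zzr r a' b' : r * z a' * z b' = r * y a' * x b' by rewrite -mulrA zz mulrA.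
have xyx a' b' c' : x a' * y b' * x c' = 0 by rewrite -mulrA -zz mulrA xz mul0r.
have xxx a' b' c' : x a' * x b' * x c' = 0.
  by rewrite -yy -mulrA -zz mulrA yz mul0r.
have yxx a' b' c' : y a' * x b' * x c' = x a' * x b' * y c'.
  by rewrite -mulrA -yy mulrA yy.
have zyx a' b' c' : z a' * y b' * x c' = 0.
  by rewrite -mulrA -zz mulrA zz xzr.
have zxxy a' b' c' e' : z a' * x b' * x c' * y e' = 0.
  by rewrite -[z a' * _ * _]mulrA -mulrA -yxx !mulrA zyx mul0r.
have xxr r a' b' c' : r * x a' * x b' * x c' = 0.
  by rewrite -!mulrA (mulrA (x _)) xxx mulr0.
have xyxr r a' b' c' : r * x a' * y b' * x c' = 0.
  by rewrite -!mulrA (mulrA (x _)) xyx mulr0.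
have zyxr r a' b' c' : r * z a' * y b' * x c' = 0.
  by rewrite -!mulrA (mulrA (z _)) zyx mulr0.
have yxxr r a' b' c' : r * y a' * x b' * x c' = r * x a' * x b' * y c'.
  by rewrite -!mulrA (mulrA (y _)) yxx !mulrA.
case: t1 => [|[|t1]]; case: t2 => [|[|t2]]; case: t3 => [|[|t3]];
  case: t4 => [|[|t4]] /=;
  by rewrite ?(xz, yz, yy, zz, xzr, yzr, yyr, zzr, xyx, xxx, yxx, zyx,
    xxr, xyxr, zyxr, yxxr, zxxy, mul0r, mulr0).
Qed.

End FourLetters.

Section ThreeLetters.
Variables (R : pzRingType) (x y : nat -> R) (z : R) (P : R -> Prop).
Hypotheses (xy : forall a b, x a * y b = 0)
  (yy : forall a b, y a * y b = x a * x b)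
  (zx : forall a, z * x a = (x a + y a) * z)
  (zy : forall a, z * y a = y a * z).
Hypotheses (P0 : P 0) (PD : forall u v, P u -> P v -> P (u + v))
  (Px : forall a, P (x a * z * z)) (Py : forall a, P (y a * z * z))
  (Pz : P (z * z * z)).

(** The first two relations already annihilate all products of three letters
    among the x_a and y_b. The other two say that z moves to the right across
    these letters at the price of the substitution x -> x + y, y -> y. Applied
    to the relations themselves, the substitution yields x_a x_b z = 0 and
    y_a x_b z = 0, hence every product reduces to products ending in z z. *)
Lemma letters3_span t1 t2 t3 a b c :
  let g := letter x y (fun=> z) in P (g t1 a * g t2 b * g t3 c).
Proof.
have xxx a' b' c' : x a' * x b' * x c' = 0.
  by rewrite -mulrA -yy mulrA xy mul0r.
have yxx a' b' c' : y a' * x b' * x c' = 0.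
  by rewrite -mulrA -yy mulrA yy -mulrA xy mulr0.
have rxy r a' b' : r * x a' * y b' = 0 by rewrite -mulrA xy mulr0.
have ryy r a' b' : r * y a' * y b' = r * x a' * x b' by rewrite -mulrA yy mulrA.
have rzx r a' : r * z * x a' = r * x a' * z + r * y a' * z.
  by rewrite -mulrA zx mulrDl mulrDr !mulrA.
have rzy r a' : r * z * y a' = r * y a' * z by rewrite -mulrA zy mulrA.
have xxz a' b' : x a' * x b' * z = 0.
  have : z * (x a' * y b') = 0 by rewrite xy mulr0.
  by rewrite mulrA zx -mulrA zy mulrA mulrDl xy add0r yy.
have yxz a' b' : y a' * x b' * z = 0.
  have : z * (x a' * x b') = z * (y a' * y b') by rewrite yy.
  rewrite !mulrA zx zy -mulrA zx -[y a' * z * _]mulrA zy !mulrA yy xxz.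
  by rewrite mulrDr !mulrDl xy yy !xxz mul0r !add0r !addr0.
case: t1 => [|[|t1]]; case: t2 => [|[|t2]]; case: t3 => [|[|t3]] /=;
  rewrite ?(xy, yy, zx, zy, mulrDl, rxy, ryy, rzx, rzy, xxx, yxx, xxz, yxz,
    mul0r, addr0) //; do ?[apply: PD => //].
Qed.

End ThreeLetters.

(** * Algebras with prescribed relations *)

(** A quadratic form is a list of terms (a, i, j), each standing for a x_i x_j.
    The variables are indexed by all natural numbers, which permits forms with
    i or j beyond the last generator: such variables will be zero. *)
Definition form_value (K : fieldType) (R : lalgType K) (g : nat -> R)
    (r : seq (K * nat * nat)) : R :=
  \sum_(t <- r) t.1.1 *: (g t.1.2 * g t.2).

Section Realization.
Variables (K : fieldType) (n d : nat).

Definition qgen (c : coef_vector K n d) (i : nat) : qalg c :=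
  \sum_(k < n) qalg_pi c (gen K k) *+ (i == k).

Lemma qgen_ord c (k : 'I_n) : qgen c k = qalg_pi c (gen K k).
Proof.
rewrite /qgen (bigD1 k) //= eqxx mulr1n big1 ?addr0 // => j jk.
by rewrite eq_sym [_ == _](negPf jk).
Qed.

Lemma qgen_out c i : (n <= i)%N -> qgen c i = 0.
Proof.
move=> ni; rewrite /qgen big1 // => k _; case: eqP => // e.
by have := ltn_ord k; lia.
Qed.

Lemma qalg_piM (c : coef_vector K n d) a b :
  qalg_pi c (a * b) = qalg_pi c a * qalg_pi c b.
Proof. by rewrite -qalg_mul_pi. Qed.

Lemma qalg_piZ (c : coef_vector K n d) (k : K) a :
  qalg_pi c (k *: a) = k *: qalg_pi c a.
Proof. by rewrite -qalg_scale_pi. Qed.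

Lemma qrel0 (c : coef_vector K n d) j : qalg_pi c (qrel c j) = 0.
Proof.
rewrite -[RHS](raddf0 (qalg_pi c)); apply/qalg_piP; rewrite subr0.
by apply/qidealP; exists [:: (1, j, 1)]; rewrite big_seq1 /= mul1r mulr1.
Qed.

Lemma realize_relations (rs : seq (seq (K * nat * nat))) : (size rs <= d)%N ->
  exists c : coef_vector K n d, forall r, r \in rs -> form_value (qgen c) r = 0.
Proof.
move=> rsd; pose f (r : seq (K * nat * nat)) (k m : 'I_n) : K :=
  \sum_(t <- r) t.1.1 *+ (t.1.2 == k) *+ (t.2 == m).
pose c : coef_vector K n d :=
  [ffun x : 'I_d * 'I_n * 'I_n => f (nth [::] rs x.1.1) x.1.2 x.2].
exists c => r rrs.
have jd : (index r rs < d)%N by rewrite (leq_trans _ rsd) // index_mem.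
rewrite -[RHS](qrel0 c (Ordinal jd)) /qrel (raddf_sum (qalg_pi c)) /=.
under [RHS]eq_bigr => k _.
  rewrite (raddf_sum (qalg_pi c)) /=.
  under eq_bigr => m _.
    rewrite qalg_piZ qalg_piM ffunE /= nth_index // /f scaler_suml.
    over.
  rewrite exchange_big; over.
rewrite exchange_big; apply: eq_bigr => t _.
rewrite {1}/qgen mulr_suml scaler_sumr; apply: eq_bigr => k _.
rewrite mulr_sumr scaler_sumr; apply: eq_bigr => m _.
by rewrite mulrnAl mulrnAr -!scalerMnr !scalerMnl mulrnAC.
Qed.

Lemma word_value_cat c s i :
  qalg_pi c (word K (s ++ [:: i])) = qalg_pi c (word K s) * qgen c i.
Proof. by rewrite -wordM qalg_piM (qgen_ord c i) gen_word. Qed.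

Lemma word_value2 c i j : qalg_pi c (word K [:: i; j]) = qgen c i * qgen c j.
Proof. by rewrite (word_value_cat c [:: i]) (qgen_ord c i) gen_word. Qed.

Lemma word_value3 c i j k :
  qalg_pi c (word K [:: i; j; k]) = qgen c i * qgen c j * qgen c k.
Proof. by rewrite (word_value_cat c [:: i; j]) word_value2. Qed.

Lemma word_value4 c i j k l : qalg_pi c (word K [:: i; j; k; l]) =
  qgen c i * qgen c j * qgen c k * qgen c l.
Proof. by rewrite (word_value_cat c [:: i; j; k]) word_value3. Qed.

Lemma rank_of_vanishing q (c : coef_vector K n d) :
  (forall w : q.-tuple 'I_n, qalg_pi c (word K w) = 0) ->
  (n ^ q <= \rank (relation_mx q c))%N.
Proof.
move=> w0; rewrite -[leqRHS]addn0.
apply: (@rank_of_span _ _ _ _ _ _ (fun=> 0)) => w.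
by exists (fun=> 0); rewrite big_ord0 w0.
Qed.

End Realization.

Lemma rank_split (K : fieldType) n d e q (c : coef_vector K n (d + e)) :
  exists (c1 : coef_vector K n d) (c2 : coef_vector K n e),
  (\rank (relation_mx q c) <=
     \rank (relation_mx q c1) + \rank (relation_mx q c2))%N.
Proof.
pose c1 : coef_vector K n d :=
  [ffun x : 'I_d * 'I_n * 'I_n => c (lshift e x.1.1, x.1.2, x.2)].
pose c2 : coef_vector K n e :=
  [ffun x : 'I_e * 'I_n * 'I_n => c (rshift d x.1.1, x.1.2, x.2)].
have E1 j : qrel c (lshift e j) = qrel c1 j.
  by apply: eq_bigr => k _; apply: eq_bigr => m _; rewrite ffunE.
have E2 j : qrel c (rshift d j) = qrel c2 j.
  by apply: eq_bigr => k _; apply: eq_bigr => m _; rewrite ffunE.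
exists c1, c2; apply: leq_trans (mxrank_adds_leqif _ _); apply: mxrankS.
apply/row_subP => x; rewrite row_relation_mx /=.
case: (split_ordP (enum_val x).2) => j ->; rewrite ?E1 ?E2.
  by rewrite (submx_trans (word_relation_sub _ _ _ _ _)) ?addsmxSl.
by rewrite (submx_trans (word_relation_sub _ _ _ _ _)) ?addsmxSr.
Qed.

(** The bound is the number of rows, so that it expresses their independence,
    which is not lost when relations are dropped. *)
Lemma rank_restrict (K : fieldType) n d0 d q (c0 : coef_vector K n d0) :
  (d <= d0)%N -> (q.-1 * n ^ q.-2 * d0 <= \rank (relation_mx q c0))%N ->
  exists c : coef_vector K n d,
    (q.-1 * n ^ q.-2 * d <= \rank (relation_mx q c))%N.
Proof.
move=> dd0; move: c0; rewrite -(subnKC dd0) => c0 rk.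
have [c1 [c2 rk12]] := rank_split q c0.
exists c1; rewrite -(leq_add2r (q.-1 * n ^ q.-2 * (d0 - d))) -mulnDr.
apply: leq_trans rk (leq_trans rk12 _); rewrite leq_add2l.
exact: leq_trans (rank_relation_mx_le q c2) (geq_minr _ _).
Qed.

(** * Degree two *)

(** Any d of the n^2 monomials x_i x_j will do. *)
Lemma rank2_witness (K : fieldType) n d : (d <= n ^ 2)%N ->
  exists c : coef_vector K n d, (d <= \rank (relation_mx 2 c))%N.
Proof.
move=> dn; pose rs := [seq [:: (1 : K, i, j)] | i <- iota 0 n, j <- iota 0 n].
have [|c0 Hc0] := @realize_relations K n (n ^ 2) rs.
  by rewrite size_allpairs size_iota.
suff /(rank_restrict dn) [c] : (1 * 1 * n ^ 2 <= \rank (relation_mx 2 c0))%N.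
  by rewrite /= expn0 !mul1n; exists c.
rewrite !mul1n; apply: rank_of_vanishing => [[[|i [|j [|k s]]] sz]] //.
rewrite word_value2; have := Hc0 [:: (1, i : nat, j : nat)].
rewrite /form_value big_seq1 scale1r; apply.
by apply: allpairs_f; rewrite mem_iota ltn_ord.
Qed.

(** * Degree four *)

Section DegreeFourWitness.
Variables (K : fieldType) (n : nat).

(** The letters of the four relations in x, y, z are numbered
    x_a = 3a, y_a = 3a + 1, z_a = 3a + 2, and each relation is indexed by its
    leading pair: x_a z_b and y_a z_b by (3a, 3b + 2) and (3a + 1, 3b + 2),
    x_a x_b - y_a y_b by (3a, 3b), and y_a x_b - z_a z_b by (3a + 1, 3b). If one
    of the two leading letters is not below n, then all terms of the relation
    vanish, so that the pairs with both letters below n suffice. *)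
Definition relation4 (i j : nat) : seq (K * nat * nat) :=
  if (j %% 3 == 2)%N then [:: (1, i, j)]
  else [:: (1, i, j); (-1, i.+1, if (i %% 3 == 0)%N then j.+1 else j.+2)].

Definition relations4 : seq (seq (K * nat * nat)) :=
  [seq relation4 i j | i <- [seq i <- iota 0 n | (i %% 3 < 2)%N],
                       j <- [seq j <- iota 0 n | (j %% 3 != 1)%N]].

(** If n = 3k, 3k + 1, 3k + 2, then there are (2k)^2, (2k + 1)^2 and
    (2k + 2)(2k + 1) leading pairs. In the middle case the bound is attained up
    to rounding: 9 (2k + 1)^2 = 4 (n^2 + n) + 1. *)
Lemma size_relations4 : (9 * size relations4 <= 4 * (n ^ 2 + n) + 1)%N.
Proof.
rewrite size_allpairs !size_filter.
have E : forall k, (count (fun i => i %% 3 < 2) (iota 0 k) = k - k %/ 3 /\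
    count (fun i => i %% 3 != 1) (iota 0 k) = k - k.+1 %/ 3)%N.
  elim=> [//|k [IH1 IH2]].
  have -> : iota 0 k.+1 = iota 0 k ++ [:: k] by rewrite -addn1 iotaD.
  rewrite !count_cat IH1 IH2 /= !addn0.
  have := @ltn_pmod k 3 isT.
  by case: (k %% 3)%N (divn_eq k 3) => [|[|[|//]]] /=; lia.
have [-> ->] := E n; have := divn_eq n 3; have := @ltn_pmod n 3 isT.
move: (n %/ 3)%N (n %% 3)%N => k r ltr ->.
have -> : (k * 3 + r - k = 2 * k + r)%N by lia.
have -> : (k * 3 + r - (k * 3 + r).+1 %/ 3 = 2 * k + (0 < r))%N by lia.
rewrite -mulnn; case: r ltr => [|[|[|//]]] _ /=; nia.
Qed.

End DegreeFourWitness.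

Lemma relations4_words (K : fieldType) (R : lalgType K) n (g : nat -> R) :
  (forall i, (n <= i)%N -> g i = 0) ->
  (forall r, r \in relations4 K n -> form_value g r = 0) ->
  forall i j k l, g i * g j * g k * g l = 0.
Proof.
move=> g0 Hg; pose x a := g (a * 3)%N; pose y a := g (a * 3).+1.
pose z a := g (a * 3).+2.
have rel i j : (i < n)%N -> (j < n)%N -> (i %% 3 < 2)%N -> (j %% 3 != 1)%N ->
    form_value g (relation4 K i j) = 0.
  move=> ltin ltjn i3 j3; apply: Hg; apply: allpairs_f;
    by rewrite mem_filter mem_iota /= ?i3 ?j3.
have g3 i : g i = letter x y z (i %% 3) (i %/ 3).
  rewrite {1}(divn_eq i 3); have := @ltn_pmod i 3 isT.
  by case: (i %% 3)%N => [|[|[|//]]] _; rewrite /= ?addn0 ?addn1 ?addn2.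
have r0 a : (a * 3 %% 3 = 0)%N by apply: modnMl.
have r1 a : ((a * 3).+1 %% 3 = 1)%N by lia.
have r2 a : ((a * 3).+2 %% 3 = 2)%N by lia.
have xz a b : x a * z b = 0.
  rewrite /x /z; have [an|/g0->] := ltnP (a * 3) n; last by rewrite mul0r.
  have [bn|/g0->] := ltnP (b * 3).+2 n; last by rewrite mulr0.
  have := rel _ _ an bn; rewrite /relation4 r0 r2.
  by move=> /(_ isT isT); rewrite /form_value big_seq1 scale1r.
have yz a b : y a * z b = 0.
  rewrite /y /z; have [an|/g0->] := ltnP (a * 3).+1 n; last by rewrite mul0r.
  have [bn|/g0->] := ltnP (b * 3).+2 n; last by rewrite mulr0.
  have := rel _ _ an bn; rewrite /relation4 r1 r2.
  by move=> /(_ isT isT); rewrite /form_value big_seq1 scale1r.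
have yy a b : y a * y b = x a * x b.
  have [an|na] := ltnP (a * 3) n; last first.
    by rewrite /x /y (g0 (a * 3).+1) ?(g0 (a * 3)%N) ?mul0r // ltnW.
  have [bn|nb] := ltnP (b * 3) n; last first.
    by rewrite /x /y (g0 (b * 3).+1) ?(g0 (b * 3)%N) ?mulr0 // ltnW.
  have := rel _ _ an bn; rewrite /relation4 !r0 => /(_ isT isT).
  rewrite /form_value big_cons big_seq1 scale1r scaleN1r => /eqP.
  by rewrite subr_eq0 => /eqP <-.
have zz a b : z a * z b = y a * x b.
  have [an|na] := ltnP (a * 3).+1 n; last first.
    by rewrite /z /y (g0 (a * 3).+2) ?(g0 (a * 3).+1) ?mul0r // ltnW.
  have [bn|nb] := ltnP (b * 3) n; last first.
    by rewrite /z /x (g0 (b * 3).+2) ?(g0 (b * 3)%N) ?mulr0 //; lia.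
  have := rel _ _ an bn; rewrite /relation4 r0 r1 => /(_ isT isT).
  rewrite /form_value big_cons big_seq1 scale1r scaleN1r => /eqP.
  by rewrite subr_eq0 => /eqP <-.
move=> i j k l; rewrite (g3 i) (g3 j) (g3 k) (g3 l).
exact: (letters4_0 xz yz yy zz).
Qed.

Lemma rank4_witness (K : fieldType) n d : (4 * (n ^ 2 + n) <= 9 * d)%N ->
  exists c : coef_vector K n d, (n ^ 4 <= \rank (relation_mx 4 c))%N.
Proof.
move=> dn; have [|c Hc] := @realize_relations K n d (relations4 K n).
  by have := size_relations4 K n; lia.
exists c; apply: rank_of_vanishing.
move=> [[|i [|j [|k [|l [|o s]]]]] sz] //.
rewrite word_value4; apply: (relations4_words _ Hc) => p; exact: qgen_out.
Qed.

(** * Degree three *)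

Section DegreeThreeWitness.
Variables (K : fieldType) (n : nat).
Notation m := (n./2.*2).

(** With m the largest even number not exceeding n, the letters are numbered
    x_a = 2a, y_a = 2a + 1 below m, and z = m, which is a generator exactly
    when n is odd. The leading pairs (i, j), with i even and j < m, stand for
    z x_a - x_a z - y_a z and z y_a - y_a z if i = m, and otherwise for x_a y_b
    and y_a y_b - x_a x_b. There are floor (n^2 / 2) of them. *)
Definition relation3 (i j : nat) : seq (K * nat * nat) :=
  if i == m then
    (1, i, j) :: (-1, j, i) :: (if odd j then [::] else [:: (-1, j.+1, i)])
  else if odd j then [:: (1, i, j)] else [:: (1, i.+1, j.+1); (-1, i, j)].

Definition relations3 : seq (seq (K * nat * nat)) :=
  [seq relation3 i j | i <- [seq i <- iota 0 n | ~~ odd i], j <- iota 0 m].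

Lemma size_relations3 : (size relations3 = uphalf n * m)%N.
Proof.
rewrite size_allpairs size_filter size_iota; congr (_ * _)%N.
elim: n => [//|k IH].
have -> : iota 0 k.+1 = iota 0 k ++ [:: k] by rewrite -addn1 iotaD.
by rewrite count_cat IH /= addn0; lia.
Qed.

(** Membership of all words in an abstract additive set P covers both uses
    below: P is either zero or the span of the elements g_l z z. *)
Lemma relations3_words (R : lalgType K) (g : nat -> R) (P : R -> Prop) :
  (forall i, (n <= i)%N -> g i = 0) ->
  (forall r, r \in relations3 -> form_value g r = 0) ->
  P 0 -> (forall u v, P u -> P v -> P (u + v)) ->
  (forall l, (l < n)%N -> P (g l * g m * g m)) ->
  forall i j k, (i < n)%N -> (j < n)%N -> (k < n)%N -> P (g i * g j * g k).
Proof.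
move=> g0 Hg P0 PD Pg; pose z := g m.
(* Without the cut-off, x_(m / 2) would be z. *)
pose x a := if (a.*2 < m)%N then g a.*2 else 0.
pose y a := if (a.*2 < m)%N then g a.*2.+1 else 0.
have rel i j : (i < n)%N -> (j < m)%N -> ~~ odd i ->
    form_value g (relation3 i j) = 0.
  move=> ltin ltjm i2; apply: Hg; apply: allpairs_f;
    by rewrite ?mem_filter mem_iota /= ?i2.
have Pg' l : P (g l * z * z).
  by have [/Pg//|/g0->] := ltnP l n; rewrite !mul0r.
have xy a b : x a * y b = 0.
  rewrite /x /y; case: ifP => [am|_]; last by rewrite mul0r.
  case: ifP => [bm|_]; last by rewrite mulr0.
  have := rel a.*2 b.*2.+1; rewrite /relation3 (ltn_eqF am) /= !odd_double /=.
  by rewrite /form_value big_seq1 scale1r => -> //; lia.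
have yy a b : y a * y b = x a * x b.
  rewrite /x /y; case: ifP => [am|_]; last by rewrite !mul0r.
  case: ifP => [bm|_]; last by rewrite !mulr0.
  have := rel a.*2 b.*2; rewrite /relation3 (ltn_eqF am) !odd_double.
  rewrite /form_value big_cons big_seq1 scale1r scaleN1r => /(_ _ _ isT) E.
  by apply: subr0_eq; apply: E; lia.
have zx a : z * x a = (x a + y a) * z.
  rewrite /x /y; case: ifP => [am|_]; last by rewrite addr0 mul0r mulr0.
  have [mn|/g0 z0] := ltnP m n; last by rewrite /z z0 mul0r mulr0.
  have := rel m a.*2 mn am; rewrite /relation3 eqxx !odd_double => /(_ isT).
  rewrite /form_value !big_cons big_nil scale1r !scaleN1r addr0.
  by rewrite mulrDl -opprD => /subr0_eq.
have zy a : z * y a = y a * z.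
  rewrite /y; case: ifP => [am|_]; last by rewrite mul0r mulr0.
  have [mn|/g0 z0] := ltnP m n; last by rewrite /z z0 mul0r mulr0.
  have := rel m a.*2.+1 mn.
  rewrite /relation3 eqxx /= !odd_double /= => /(_ _ isT).
  rewrite /form_value !big_cons big_nil scale1r scaleN1r addr0.
  by move=> E; apply: subr0_eq; apply: E; lia.
have gE l : (l < n)%N -> exists t a, g l = letter x y (fun=> z) t a.
  have [lm ln|ml ln] := ltnP l m; last first.
    by exists 2%N, 0%N; congr g; lia.
  exists (odd l), l./2; have lm2 : (l./2.*2 < m)%N by lia.
  rewrite -{1}(odd_double_half l).
  by case: (odd l); rewrite /= /x /y lm2 ?add0n ?add1n.
move=> i j k /gE[t1 [a ->]] /gE[t2 [b ->]] /gE[t3 [e ->]].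
apply: (letters3_span xy yy zx zy P0 PD) => [a'|a'|]; last exact: Pg'.
- by rewrite /x; case: ifP => // _; rewrite !mul0r.
- by rewrite /y; case: ifP => // _; rewrite !mul0r.
Qed.

Lemma relations3_words_eq0 (R : lalgType K) (g : nat -> R) :
  (forall i, (n <= i)%N -> g i = 0) ->
  (forall r, r \in relations3 -> form_value g r = 0) ->
  g m * g m = 0 ->
  forall i j k, (i < n)%N -> (j < n)%N -> (k < n)%N -> g i * g j * g k = 0.
Proof.
move=> g0 Hg gm0; apply: (relations3_words (P := eq^~ 0) g0 Hg) => //.
  by move=> u v -> ->; rewrite addr0.
by move=> l _; rewrite -mulrA gm0 mulr0.
Qed.

Lemma relations3_words_span (R : lalgType K) (g : nat -> R) :
  (forall i, (n <= i)%N -> g i = 0) ->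
  (forall r, r \in relations3 -> form_value g r = 0) ->
  forall i j k, (i < n)%N -> (j < n)%N -> (k < n)%N ->
    exists a : 'I_n -> K, g i * g j * g k = \sum_l a l *: (g l * g m * g m).
Proof.
move=> g0 Hg; pose P (u : R) :=
  exists a : 'I_n -> K, u = \sum_l a l *: (g l * g m * g m).
apply: (relations3_words (P := P) g0 Hg).
- by exists (fun=> 0); rewrite big1 // => l _; rewrite scale0r.
- move=> u v [a ->] [b ->]; exists (fun l => a l + b l).
  by rewrite -big_split /=; apply: eq_bigr => l _; rewrite scalerDl.
- move=> l ln; exists (fun p => (p == Ordinal ln)%:R).
  rewrite (bigD1 (Ordinal ln)) //= eqxx scale1r big1 ?addr0 // => p /negPf->.
  by rewrite scale0r.
Qed.

End DegreeThreeWitness.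

Lemma uphalf_half_sqr n : (2 * (uphalf n * n./2.*2) + odd n = n ^ 2)%N.
Proof.
rewrite uphalf_half -{5}(odd_double_half n) -mulnn.
by case: (odd n); move: n./2 => k /=; nia.
Qed.

(** For odd n the additional relation z z kills the n products g_l z z that the
    other relations leave over. *)
Lemma rank3_spanning (K : fieldType) n d : (n ^ 2 <= 2 * d)%N ->
  exists c : coef_vector K n d, (n ^ 3 <= \rank (relation_mx 3 c))%N.
Proof.
move=> nd; pose m := n./2.*2.
pose zz : seq (seq (K * nat * nat)) := nseq (odd n) [:: (1, m, m)].
have [|c Hc] := @realize_relations K n d (relations3 K n ++ zz).
  have := uphalf_half_sqr n; rewrite size_cat size_relations3 size_nseq.
  by case: (odd n) => /=; lia.
have zz0 : qgen c m * qgen c m = 0.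
  have [on|en] := boolP (odd n); last first.
    by rewrite [qgen c m]qgen_out ?mul0r // /m; lia.
  have := Hc [:: (1, m, m)]; rewrite mem_cat /zz on inE eqxx orbT => /(_ isT).
  by rewrite /form_value big_seq1 scale1r.
exists c; apply: rank_of_vanishing.
move=> [[|i [|j [|k [|o s]]]] sz] //; rewrite word_value3.
apply: (relations3_words_eq0 (g := qgen c) (qgen_out c) _ zz0) => // r rr.
by apply: Hc; rewrite mem_cat rr.
Qed.

(** For d = floor (n^2 / 2) the n^3 - 2nd remaining dimensions (none for n even,
    n for n odd) are accounted for by the products g_l z z. *)
Lemma rank3_free (K : fieldType) n :
  let d := (uphalf n * n./2.*2)%N in
  exists c : coef_vector K n d, (2 * n * d <= \rank (relation_mx 3 c))%N.
Proof.
move=> d; have [on|en] := boolP (odd n); last first.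
  have [|c rc] := @rank3_spanning K n d.
    by have := uphalf_half_sqr n; lia.
  exists c; apply: leq_trans rc; rewrite expnS -uphalf_half_sqr.
  by rewrite (negPf en) -/d; nia.
have [|c Hc] := @realize_relations K n d (relations3 K n).
  by rewrite size_relations3.
have mn : (n./2.*2 < n)%N by lia.
pose o := Ordinal mn; exists c.
pose e (l : 'I_n) := word K [:: l; o; o].
have : (n ^ 3 <= \rank (relation_mx 3 c) + n)%N.
  apply: (@rank_of_span _ _ _ _ _ _ e).
  move=> [[|i [|j [|k [|? s]]]] sz]; try by discriminate sz.
  have [a Ea] := relations3_words_span (qgen_out c) Hc
    (ltn_ord i) (ltn_ord j) (ltn_ord k).
  exists a; apply: (etrans (word_value3 c i j k)); apply: (etrans Ea).
  apply: eq_bigr => l _; congr (_ *: _); apply: esym.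
  exact: (word_value3 c l o o).
suff : (2 * n * d + n = n ^ 3)%N by lia.
by rewrite expnS -uphalf_half_sqr on -/d; nia.
Qed.

(** For n^2 <= 2d the products fill all of degree three. Otherwise
    d <= floor (n^2 / 2), and relations are dropped from an independent
    system. *)
Lemma rank3_witness (K : fieldType) n d : exists c : coef_vector K n d,
  (minn (n ^ 3) (2 * n * d) <= \rank (relation_mx 3 c))%N.
Proof.
have [dn|dn] := leqP (n ^ 2) (2 * d).
  have [c rc] := rank3_spanning K dn.
  by exists c; apply: leq_trans rc; apply: geq_minl.
have [c0 rc0] := rank3_free K n.
have [|c rc] := @rank_restrict K n _ d 3 c0 _ rc0.
  by have := uphalf_half_sqr n; lia.
by exists c; apply: leq_trans rc; apply: geq_minr.
Qed.

(** * The Golod-Shafarevich series *)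

Section GolodShafarevich.
Variables n d : nat.

Let p : {poly int} := 1 - n%:Z *: 'X + d%:Z *: 'X^2.
Let b : nat -> int := fps_inv (fps_of_poly p).

Let coef_p k :
  fps_of_poly p k = (k == 0%N)%:R - n%:Z * (k == 1%N)%:R + d%:Z * (k == 2%N)%:R.
Proof.
by rewrite /fps_of_poly /p coefD coefB !coefZ coef1 coefX coefXn.
Qed.

Let mulV : fps_mul (fps_of_poly p) b =1 fps_of_poly 1.
Proof. by apply: fps_mulV; rewrite coef_p /= !mulr0 subr0 addr0 unitr1. Qed.

Lemma gs_inv0 : b 0 = 1.
Proof.
have := mulV 0; rewrite /fps_mul big_ord1 coef_p /= !mulr0 subr0 addr0 mul1r.
by rewrite /fps_of_poly coef1.
Qed.

Lemma gs_inv1 : b 1 = n%:Z.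
Proof.
have := mulV 1; rewrite /fps_mul !big_ord_recl big_ord0 !coef_p /= gs_inv0.
rewrite /fps_of_poly coef1 /= subn0 => E.
by apply/eqP; rewrite -subr_eq0 -[X in _ == X]E; apply/eqP; ring.
Qed.

Lemma gs_invSS k : b k.+2 = n%:Z * b k.+1 - d%:Z * b k.
Proof.
have := mulV k.+2; rewrite /fps_mul !big_ord_recl big1 => [|i _]; last first.
  by rewrite coef_p /= !mulr0 subr0 addr0 mul0r.
rewrite !coef_p /fps_of_poly coef1 /= /bump /= !subSS !subn0 => E.
by apply/eqP; rewrite -subr_eq0 -[X in _ == X]E; apply/eqP; ring.
Qed.

(** The coefficients b_k of the inverse satisfy b_(k+2) = n b_(k+1) - d b_k. If
    b_3 >= 0, that is 2d <= n^2, then b_4 = n^4 - 3 n^2 d + d^2 < 0 because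
    4 n^2 / 9 <= d; so the truncation occurs in degree 3 or 4. *)
Lemma golod_shafarevich_poly : (0 < n)%N -> (d <= n ^ 2)%N ->
  (4 * (n ^ 2 + n) <= 9 * d)%N ->
  golod_shafarevich n d =1
    fps_of_poly (1 + n%:Z *: 'X + (n%:Z ^+ 2 - d%:Z) *: 'X^2 +
                 Num.max 0 (n%:Z ^+ 3 - 2 * n%:Z * d%:Z) *: 'X^3).
Proof.
move=> n_gt0 dn nd k.
rewrite /fps_of_poly !coefD !coefZ coef1 coefX !coefXn.
have b2 : b 2 = n%:Z ^+ 2 - d%:Z.
  by rewrite gs_invSS gs_inv1 gs_inv0 mulr1 expr2.
have b3 : b 3 = n%:Z ^+ 3 - 2 * n%:Z * d%:Z.
  by rewrite gs_invSS b2 gs_inv1; ring.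
have b4 : b 4 = n%:Z ^+ 4 - 3 * n%:Z ^+ 2 * d%:Z + d%:Z ^+ 2.
  by rewrite gs_invSS b3 b2; ring.
have b2_ge0 : 0 <= b 2 by rewrite b2; lia.
have b34 : b 3 < 0 \/ b 4 < 0.
  have [b3_lt0|b3_ge0] := ltrP (b 3) 0; [by left|right].
  have dn2 : (2 * d <= n ^ 2)%N by move: b3_ge0; rewrite b3; nia.
  (* b 4 is convex in d, and negative for 9d = 4n^2 and for 2d = n^2. *)
  rewrite b4; move: nd dn2 n_gt0; nia.
have pos i : (i <= 2)%N -> 0 <= b i.
  by case: i => [|[|[|//]]] _; rewrite ?gs_inv0 ?gs_inv1.
have abs_pos j : (forall i, (i <= j)%N -> 0 <= b i) -> fps_abs b j = b j.
  move=> bj; rewrite /fps_abs ifT //; apply/forallP => i.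
  by apply: bj; rewrite -ltnS.
have abs_neg i j : (i <= j)%N -> b i < 0 -> fps_abs b j = 0.
  rewrite -ltnS => ij bi; rewrite /fps_abs ifF //; apply/negP => /forallP.
  by move=> /(_ (Ordinal ij)) /=; rewrite leNgt bi.
rewrite /golod_shafarevich -/p -/b.
case: k => [|[|[|[|k]]]] /=; rewrite !mulr0 ?mulr1 ?addr0 ?add0r.
- by rewrite abs_pos ?gs_inv0 // => i i0; apply: pos; lia.
- by rewrite abs_pos ?gs_inv1 // => i i1; apply: pos; lia.
- by rewrite abs_pos ?b2.
- rewrite -b3; have [b3_lt0|b3_ge0] := ltrP (b 3) 0.
    by rewrite (abs_neg 3%N).
  rewrite abs_pos // => i; rewrite leq_eqVlt => /orP[/eqP-> //|].
  by rewrite ltnS; apply: pos.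
- by case: b34 => [/abs_neg|/abs_neg]; apply.
Qed.

End GolodShafarevich.

(** * The Hilbert series *)

Section Hilbert.
Variables (K : fieldType) (n d : nat) (c : coef_vector K n d).

Lemma qrel_lin_indep : (d <= \rank (relation_mx 2 c))%N -> lin_indep (qrel c).
Proof.
move=> rc; pose E : 'M[K]_(d, _) := \matrix_j coef_row 2 (qrel c j).
have free : row_free E.
  rewrite -row_leq_rank (leq_trans rc) // mxrankS //; apply/row_subP => x.
  rewrite row_relation_mx; case: (enum_val x) => [[i s] j] /=.
  rewrite /prefix_of /suffix_of /= (tuple0 s) /= word_nil mul1r mulr1.
  by have := row_sub j E; rewrite rowK.
move=> a a0 j; suff : \row_i a i = 0 by move/rowP/(_ j); rewrite !mxE.
apply: (row_free_inj free); rewrite mul0mx mulmx_sum_row.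
rewrite -[RHS](raddf0 (coef_row 2)) -a0 (raddf_sum (coef_row 2)).
by apply: eq_bigr => i _; rewrite rowK mxE /= coef_rowZ.
Qed.

(** Once all words of length 4 lie in the ideal, so do all longer ones. *)
Lemma rank_full_ge4 q : (n ^ 4 <= \rank (relation_mx 4 c))%N -> (4 <= q)%N ->
  \rank (relation_mx q c) = (n ^ q)%N.
Proof.
move=> rc q4; apply/eqP; rewrite eqn_leq; apply/andP; split.
  exact: leq_trans (rank_relation_mx_le q c) (geq_minl _ _).
have full : row_full (relation_mx 4 c).
  by rewrite -col_leq_rank (leq_trans _ rc) // card_words.
apply: rank_of_vanishing => w; rewrite -(cat_take_drop 4 w) -wordM.
rewrite -[RHS](raddf0 (qalg_pi c)); apply/qalg_piP; rewrite subr0.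
have sz : size (take 4 w) == 4%N by rewrite size_takel // size_tuple.
apply: qidealMr; rewrite -(@coef_rowK K n 4 (word K (take 4 w))).
  by apply: of_row_ideal; apply: submx_full.
move=> v; rewrite -mcoeff_neq0 mcoeff_word.
by case: (take 4 w =P v) => [wv _|]; rewrite ?eqxx // /fdeg -wv (eqP sz).
Qed.

Lemma hilbert_series_of_ranks (H : nat -> int) :
  (d <= n ^ 2)%N ->
  (d <= \rank (relation_mx 2 c))%N ->
  (minn (n ^ 3) (2 * n * d) <= \rank (relation_mx 3 c))%N ->
  (n ^ 4 <= \rank (relation_mx 4 c))%N ->
  H =1 fps_of_poly (1 + n%:Z *: 'X + (n%:Z ^+ 2 - d%:Z) *: 'X^2 +
                 Num.max 0 (n%:Z ^+ 3 - 2 * n%:Z * d%:Z) *: 'X^3) ->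
  is_hilbert_series c H.
Proof.
move=> dn r2 r3 r4 HE q.
exists (n ^ q - \rank (relation_mx q c))%N; first exact: component_dim.
rewrite HE /fps_of_poly !coefD !coefZ coef1 coefX !coefXn.
have rle := rank_relation_mx_le q c.
case: q rle => [|[|[|[|q]]]] rle /=; rewrite !mulr0 ?mulr1 ?addr0 ?add0r.
- by have -> : \rank (relation_mx 0 c) = 0%N by lia.
- have -> : \rank (relation_mx 1 c) = 0%N by lia.
  by rewrite subn0 expn1.
- have -> : \rank (relation_mx 2 c) = d.
    apply/eqP; rewrite eqn_leq r2 andbT (leq_trans rle) //.
    by rewrite expn0 !mul1n geq_minr.
  by rewrite -subzn // natrX.
- have -> : \rank (relation_mx 3 c) = minn (n ^ 3) (2 * n * d).
    by apply/eqP; rewrite eqn_leq rle.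
  have -> : n%:Z ^+ 3 - 2 * n%:Z * d%:Z = (n ^ 3)%N%:Z - (2 * n * d)%N%:Z.
    by rewrite !PoszM -rmorphXn.
  by case: lerP; lia.
- have -> : \rank (relation_mx q.+4 c) = (n ^ q.+4)%N.
    exact: rank_full_ge4.
  by rewrite subnn.
Qed.

End Hilbert.

Unset Implicit Arguments.

Theorem theorem1p2 (K : fieldType)
    (K_infinite : forall s : seq K, exists x : K, x \notin s)
    (n d : nat) (n_gt0 : (0 < n)%N)
    (d_ge : (4 * (n ^ 2 + n))%N%:R / 9%:R <= d%:R :> rat)
    (d_le : (d <= n ^ 2)%N) :
  generic (fun c : coef_vector K n d =>
    lin_indep (qrel c) /\ is_hilbert_series c (golod_shafarevich n d)) /\
  golod_shafarevich n d =1
    fps_of_poly (1 + n%:Z *: 'X + (n%:Z ^+ 2 - d%:Z) *: 'X^2 +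
                 Num.max 0 (n%:Z ^+ 3 - 2 * n%:Z * d%:Z) *: 'X^3).
Proof.
have nd : (4 * (n ^ 2 + n) <= 9 * d)%N.
  by move: d_ge; rewrite ler_pdivrMr // -natrM ler_nat [(d * 9)%N]mulnC.
have gs := golod_shafarevich_poly n_gt0 d_le nd; split=> //.
have [c2 r2] := rank2_witness K d_le.
have [c3 r3] := rank3_witness K n d.
have [c4 r4] := rank4_witness K nd.
have [p [p0 Hp]] := off_hypersurface_and K_infinite (rank_off_hypersurface r2)
  (off_hypersurface_and K_infinite (rank_off_hypersurface r3)
    (rank_off_hypersurface r4)).
apply: off_hypersurface_generic => //.
exists p; split=> // c /Hp[rc2 [rc3 rc4]].
split; first exact: qrel_lin_indep.
exact: hilbert_series_of_ranks.
Qed.
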